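(* Let $m\ge1$ be an integer, $p\in\mathcal{P}_m=[0,1]^m$ and $0\le\rho_l'\le\rho_l<\rho_u\le\rho_u'\le1$. Let $\hat{\bm{\Gamma}}_m$ and $\hat{\bm{\Gamma}}_m'$ be the sets of transition probability matrices associated with $(\rho_l,\rho_u)$ and $(\rho_l',\rho_u')$, respectively. Then: (i) $\rho_l=0$ and $\rho_u=1$ imply $\operatorname{conv}\hat{\bm{\Gamma}}_m=\mathcal{T}_m$; (ii) $\rho_l'<\rho_l$ or $\rho_u<\rho_u'$ implies $\operatorname{conv}\hat{\bm{\Gamma}}_m\subsetneq\operatorname{conv}\hat{\bm{\Gamma}}_m'$; (iii) $p\in(\rho_l,\rho_u)^m$ implies $\mathbf{1}_{2^m}f(p)^\top\in\operatorname{relint}\operatorname{conv}\hat{\bm{\Gamma}}_m$.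
   Context: For $p\in\mathcal{P}_m=[0,1]^m$ let $$f(p)=\begin{bmatrix}1-p_1\\ p_1\end{bmatrix}\otimes\begin{bmatrix}1-p_2\\ p_2\end{bmatrix}\otimes\cdots\otimes\begin{bmatrix}1-p_m\\ p_m\end{bmatrix}\in\mathbb{R}^{2^m}.$$ For constants $0\le\rho_l\le\rho_u\le1$ let $\hat{\bm{t}}_m=\{f(p): p\in\mathcal{P}_m,\ p_i\in\{\rho_l,\rho_u\}\text{ for all }i\}$ and $\hat{\bm{\Gamma}}_m=\{[t_1\ t_2\ \cdots\ t_{2^m}]^\top: t_i\in\hat{\bm{t}}_m\text{ for all }i\}$, i.e. the set of $2^m\times2^m$ matrices all of whose rows are (transposes of) elements of $\hat{\bm{t}}_m$. $\mathcal{T}_m$ is the set of all $2^m\times2^m$ row-stochastic matrices (non-negative entries, each row summing to one). $\mathbf{1}_{2^m}$ is the $2^m$-dimensional column vector of ones, $\operatorname{conv}$ denotes the convex hull, $\operatorname{relint}$ the relative interior, and $\otimes$ the Kronecker product. *)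

(* Defs.v *)
From HB Require Import structures.
From mathcomp Require Import all_boot all_order all_algebra.
From mathcomp Require Import mxtens.
From mathcomp Require Import all_classical all_reals all_analysis.

Set Implicit Arguments.
Unset Strict Implicit.
Unset Printing Implicit Defensive.

Import Order.TTheory GRing.Theory Num.Theory.
Import numFieldNormedType.Exports.

Local Open Scope classical_set_scope.
Local Open Scope ring_scope.

Section Hulls.
Context {R : realType}.

Definition conv_hull {V : lmodType R} (A : set V) : set V :=
  smallest (@convex_set R V) A.

Definition affine_set {V : lmodType R} (A : set V) : Prop :=
  forall (x y : V) (t : R), A x -> A y -> A (t *: x + (1 - t) *: y).

Definition affine_hull {V : lmodType R} (A : set V) : set V :=
  smallest affine_set A.

(* Interior in the subspace topology of the affine hull. *)
Definition relint {V : normedModType R} (A : set V) : set V :=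
  [set x | A x /\ \forall y \near within (affine_hull A) (nbhs x), A y].

End Hulls.

Section TransitionMatrices.
Context {R : realType}.

(* v 0 (x) (v 1 (x) (... (x) v (m - 1))), with the convention that the empty
   product is the 1 x 1 matrix 1. The cast is needed because [2 ^ m.+1] and
   [2 * 2 ^ m] are not convertible; [1 * 1] and [1] are. *)
Fixpoint kron_col (m : nat) : ('I_m -> 'cV[R]_2) -> 'cV[R]_(2 ^ m) :=
  match m with
  | 0 => fun _ => const_mx 1
  | m'.+1 => fun v =>
      castmx (esym (expnS 2 m'), erefl 1%N)
        (tensmx (v ord0) (kron_col (fun i => v (lift ord0 i))))
  end.

Definition cube (m : nat) : set 'rV[R]_m :=
  [set p | forall i, 0 <= p 0 i <= 1].

Definition fprob (m : nat) (p : 'rV[R]_m) : 'cV[R]_(2 ^ m) :=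
  kron_col (fun i => \col_(k < 2) if k == 0 then 1 - p 0 i else p 0 i).

Definition hat_t (m : nat) (rl ru : R) : set 'cV[R]_(2 ^ m) :=
  [set fprob p | p in
    [set p : 'rV[R]_m | cube p /\ forall i, p 0 i = rl \/ p 0 i = ru]].

Definition hat_Gamma (m : nat) (rl ru : R) : set 'M[R]_(2 ^ m) :=
  [set M | forall i, hat_t rl ru (row i M)^T].

Definition row_stochastic (m : nat) : set 'M[R]_(2 ^ m) :=
  [set M | (forall i j, 0 <= M i j) /\ (forall i, \sum_j M i j = 1)].

End TransitionMatrices.

Arguments cube {R} m.
Arguments hat_t {R} m rl ru.
Arguments hat_Gamma {R} m rl ru.
Arguments row_stochastic {R} m.

(* Main.v *)
(** Interpolating affinely between [a] and [b] in each coordinate acts on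
    [fprob] as the matrix [T], the [m]-th Kronecker power of the 2 x 2 matrix
    with columns [(1 - a, a)] and [(1 - b, b)]. It sends the unit vectors, i.e.
    the values of [fprob] on [{0, 1}^m], to those on [{a, b}^m], and for [a < b]
    its inverse has the same shape. Since every row-stochastic matrix is a
    convex combination of 0-1 ones, [conv (hat_Gamma a b)] is exactly the set of
    [M] such that [M (T^-1)^T] is row stochastic. On a matrix whose rows are all
    [fprob p], [T^-1] merely rescales [p] affinely, from [a, b] to [0, 1]: the
    result is entrywise positive if [p] is in the open cube (a, b)^m, whence
    (iii), and has a negative entry if [p] is constant and outside [a, b],
    whence strictness in (ii). *)
Require Import Defs.
From HB Require Import structures.
From mathcomp Require Import all_boot all_order all_algebra.
From mathcomp Require Import mxtens ring.
From mathcomp Require Import all_classical all_reals all_analysis.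

Set Implicit Arguments.
Unset Strict Implicit.
Unset Printing Implicit Defensive.

Import Order.TTheory GRing.Theory Num.Theory.
Import numFieldNormedType.Exports.
Local Open Scope classical_set_scope.
Local Open Scope ring_scope.

(** * Finite convex combinations *)

Section Convexity.
Context {R : realType}.

Lemma convex_setP (V : lmodType R) (A : set V) :
  @convex_set R V A <->
  (forall x y (t : R), 0 <= t <= 1 -> A x -> A y -> A (t *: x + (1 - t) *: y)).
Proof.
split=> [cA x y t t01 Ax Ay|cA x y l]; last first.
  rewrite !inE => Ax Ay; apply: (cA x y l%:num) => //.
  by rewrite ge0 le1.
have t0 : 0 <= t by case/andP: t01.
have t1 : t <= 1 by case/andP: t01.
have := cA x y (Itv01 t0 t1); rewrite !inE; exact.
Qed.

Lemma conv_hull_convex (V : lmodType R) (A : set V) :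
  @convex_set R V (conv_hull A).
Proof.
apply/convex_setP => x y t t01 Ax Ay B [cB AB].
by move/convex_setP: (cB); apply=> //; [apply: Ax|apply: Ay].
Qed.

Lemma convex_set_sum (V : lmodType R) (A : set V) (I : finType)
    (c : I -> R) (x : I -> V) :
  @convex_set R V A -> (forall i, 0 <= c i) -> \sum_i c i = 1 ->
  (forall i, A (x i)) -> A (\sum_i c i *: x i).
Proof.
move=> /convex_setP cA c0 c1 Ax.
(* Here [y] is the barycentre of the terms already absorbed and [t] their total weight, so each
   induction step is a binary convex combination. *)
have main (s : seq I) : forall (t : R) y, 0 <= t -> A y ->
    t + \sum_(i <- s) c i = 1 ->
    A (t *: y + \sum_(i <- s) c i *: x i).
  elim: s => [|i s IH] t y t0 Ay.
    by rewrite !big_nil !addr0 => ->; rewrite scale1r.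
  rewrite !big_cons !addrA => sum1.
  (* A zero total cannot be renormalised; both terms vanish and [y] is kept with weight 0. *)
  have [tc0|tc0] := eqVneq (t + c i) 0.
    have /andP[/eqP -> /eqP ->] : (t == 0) && (c i == 0).
      by rewrite -paddr_eq0// tc0.
    rewrite !scale0r addr0 -[X in A (X + _)](scale0r y).
    by apply: (IH 0 y) => //; rewrite -[X in X + _]tc0.
  have tc_gt0 : 0 < t + c i by rewrite lt_neqAle eq_sym tc0 addr_ge0.
  have -> : t *: y + c i *: x i =
      (t + c i) *: ((t / (t + c i)) *: y + (1 - t / (t + c i)) *: x i).
    rewrite scalerDr !scalerA; congr (_ *: _ + _ *: _); field => //.
  apply: IH => //; first exact: addr_ge0.
  apply: cA => //; rewrite divr_ge0 ?addr_ge0//=.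
  by rewrite ler_pdivrMr// mul1r lerDl.
have [i0 _|no] := pickP (fun _ : I => true); last first.
  by move: c1; rewrite big_pred0// => /esym/eqP; rewrite oner_eq0.
rewrite -[X in A X]add0r -[X in A (X + _)](scale0r (x i0)).
apply: (main _ 0 (x i0)) => //.
by rewrite add0r.
Qed.

End Convexity.

(** * Kronecker products and powers, entry by entry *)

Section Kronecker.
Context {R : realType}.

Definition ber (x : R) : 'cV[R]_2 := \col_(k < 2) if k == 0 then 1 - x else x.

Definition chan (a b : R) : 'M[R]_2 :=
  \matrix_(k, l) ber (if l == 0 then a else b) k 0.

Fixpoint kron_pow (m : nat) (A : 'M[R]_2) : 'M[R]_(2 ^ m) :=
  match m with
  | 0 => 1%:M
  | m'.+1 => castmx (esym (expnS 2 m'), esym (expnS 2 m'))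
               (tensmx A (kron_pow m' A))
  end.

Lemma kron_colS m (v : 'I_m.+1 -> 'cV[R]_2) k l :
  kron_col v (cast_ord (esym (expnS 2 m)) (mxtens_index (k, l))) 0 =
  v ord0 k 0 * kron_col (fun i => v (lift ord0 i)) l 0.
Proof.
rewrite /= castmxE /= cast_ordK mxE mxtens_indexK.
by congr (_ * _); [congr (v _ _ _)|congr (kron_col _ _ _)]; rewrite !ord1.
Qed.

(** Splits an index into its leading bit and the rest, in the very shape that [kron_colS]
    rewrites. *)
Variant exp_index_spec m : 'I_(2 ^ m.+1) -> Type :=
  ExpIndex k l :
    exp_index_spec (cast_ord (esym (expnS 2 m)) (mxtens_index (k, l))).

Lemma exp_indexP m (i : 'I_(2 ^ m.+1)) : exp_index_spec i.
Proof.
rewrite -[i](cast_ordK (expnS 2 m)).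
by case: (mxtens_indexP (cast_ord _ i)) => k l; constructor.
Qed.

Lemma eq_kron_col m (v w : 'I_m -> 'cV[R]_2) :
  (forall i, v i = w i) -> kron_col v = kron_col w.
Proof. by move=> vw; congr kron_col; apply/funext. Qed.

Lemma kron_col_ge0 m (v : 'I_m -> 'cV[R]_2) :
  (forall i k, 0 <= v i k 0) -> forall k, 0 <= kron_col v k 0.
Proof.
elim: m v => [|m IH] v v0 k; first by rewrite mxE.
by case: (exp_indexP k) => i j; rewrite kron_colS mulr_ge0 ?IH.
Qed.

Lemma kron_col_gt0 m (v : 'I_m -> 'cV[R]_2) :
  (forall i k, 0 < v i k 0) -> forall k, 0 < kron_col v k 0.
Proof.
elim: m v => [|m IH] v v0 k; first by rewrite mxE.
by case: (exp_indexP k) => i j; rewrite kron_colS mulr_gt0 ?IH.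
Qed.

Lemma kron_col_sum m (v : 'I_m -> 'cV[R]_2) :
  \sum_k kron_col v k 0 = \prod_i \sum_k v i k 0.
Proof.
elim: m v => [|m IH] v.
  by rewrite big_ord0 (big_ord1 _ (fun k => kron_col v k 0)) mxE.
rewrite big_ord_recl -IH mulr_sum.
rewrite (reindex (cast_ord (esym (expnS 2 m)))); last first.
  by exists (cast_ord (expnS 2 m)) => k _; rewrite ?cast_ordK ?cast_ordKV.
apply: eq_bigr => k _; case: (mxtens_indexP k) => i j.
by rewrite -/(kron_col v) kron_colS mxtens_indexK.
Qed.

(** The target dimensions are variables so that the equations can be destructed, which [expnS 2 m']
    does not permit. *)
Lemma mulmx_castmx n n' p p' (en : n = n') (ep : p = p')
    (M : 'M[R]_n) (N : 'M[R]_(n, p)) :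
  castmx (en, en) M *m castmx (en, ep) N = castmx (en, ep) (M *m N).
Proof. by case: n' / en; case: p' / ep; rewrite !castmx_id. Qed.

Lemma kron_col_mul m (A : 'M[R]_2) (v : 'I_m -> 'cV[R]_2) :
  kron_col (fun i => A *m v i) = kron_pow m A *m kron_col v.
Proof.
elim: m v => [|m IH] v /=; first by rewrite mul1mx.
by rewrite IH -tensmx_mul; symmetry; apply: mulmx_castmx.
Qed.

Lemma kron_powM m (A B : 'M[R]_2) :
  kron_pow m (A *m B) = kron_pow m A *m kron_pow m B.
Proof.
elim: m => [|m IH] /=; first by rewrite mul1mx.
by rewrite IH -tensmx_mul mulmx_castmx.
Qed.

Lemma kron_pow1 m : kron_pow m 1%:M = 1%:M.
Proof.
elim: m => [//|m IH] /=; apply/matrixP => i j.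
case: (exp_indexP i) => i1 i2; case: (exp_indexP j) => j1 j2.
rewrite castmxE !cast_ordK tensmxE IH !mxE -natrM mulnb.
by rewrite (inj_eq (@cast_ord_inj _ _ _)) (can_eq (@mxtens_indexK _ _)).
Qed.

Lemma berE (x : R) k : ber x k 0 = if k == 0 then 1 - x else x.
Proof. by rewrite mxE. Qed.

Lemma chan_ber (a b x : R) :
  chan a b *m ber x = ber ((1 - x) * a + x * b).
Proof.
apply/colP => k; rewrite !mxE !big_ord_recl big_ord0 !mxE /=.
by case: ifP => _; ring.
Qed.

(** The columns of [chan c d] are [ber c] and [ber d], so [chan_ber] applies column by column. *)
Lemma chanM (a b c d : R) :
  chan a b *m chan c d = chan ((1 - c) * a + c * b) ((1 - d) * a + d * b).
Proof.
apply/matrixP => k l; rewrite [RHS]mxE.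
have := chan_ber a b (if l == 0 then c else d) => /matrixP/(_ k 0).
rewrite mxE => H; rewrite mxE; under eq_bigr do rewrite [chan c d _ _]mxE.
by rewrite H; case: ifP.
Qed.

Lemma chan01 : chan 0 1 = 1%:M.
Proof.
apply/matrixP => k l; rewrite !mxE.
by case: k => [[|[|]]] //= ?; case: l => [[|[|]]] //= ?; rewrite ?subr0 ?subrr.
Qed.

End Kronecker.

(** * Product Bernoulli laws under affine changes of parameter *)

Section FprobTheory.
Context {R : realType}.

Implicit Types (a b : R) (m : nat).

Lemma fprobE m (p : 'rV[R]_m) : fprob p = kron_col (fun i => ber (p 0 i)).
Proof. by []. Qed.

Lemma sum_ber (x : R) : \sum_k ber x k 0 = 1.
Proof. by rewrite !big_ord_recl big_ord0 !berE /=; ring. Qed.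

Lemma fprob_sum m (p : 'rV[R]_m) : \sum_k fprob p k 0 = 1.
Proof. by rewrite fprobE kron_col_sum big1// => i _; rewrite sum_ber. Qed.

Lemma fprob_ge0 m (p : 'rV[R]_m) : cube m p -> forall k, 0 <= fprob p k 0.
Proof.
move=> p01; apply: kron_col_ge0 => i k; rewrite berE.
by have /andP[? ?] := p01 i; case: ifP => _; rewrite ?subr_ge0.
Qed.

Lemma fprob_gt0 m (p : 'rV[R]_m) :
  (forall i, 0 < p 0 i < 1) -> forall k, 0 < fprob p k 0.
Proof.
move=> p01; apply: kron_col_gt0 => i k; rewrite berE.
by have /andP[? ?] := p01 i; case: ifP => _; rewrite ?subr_gt0.
Qed.

(** The coordinates of [e] are the binary digits of [k], leading digit first: a Bernoulli law with
    parameter 0 or 1 is a point mass. *)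
Lemma fprob_delta m (k : 'I_(2 ^ m)) :
  exists2 e : 'rV[R]_m, forall i, e 0 i = 0 \/ e 0 i = 1 &
    fprob e = delta_mx k 0.
Proof.
elim: m k => [|m IH] k.
  exists 0; first by move=> i; left; rewrite mxE.
  by apply/colP => i; rewrite !mxE [i]ord1 [k]ord1.
case: (exp_indexP k) => i j {k}; have [e e01 ej] := IH j.
exists (\row_l (if unlift ord0 l is Some l' then e 0 l' else (i != 0)%:R)).
  move=> l; rewrite mxE; case: unliftP => [l' _|_]; first exact: e01.
  by case: (i != 0); [right|left].
apply/colP => k; case: (exp_indexP k) => i' j' {k}.
rewrite fprobE kron_colS mxE unlift_none
  (@eq_kron_col _ _ _ (fun l => ber (e 0 l))).
  2: by move=> l; rewrite mxE liftK.
rewrite -fprobE ej berE !mxE eqxx !andbT.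
rewrite (inj_eq (@cast_ord_inj _ _ _)) (can_eq (@mxtens_indexK _ _)) xpair_eqE.
rewrite -mulnb natrM; congr (_ * _).
by case: i => [[|[|]]] //= ?; case: i' => [[|[|]]] //= ?; rewrite ?subr0 ?subrr.
Qed.

(* Summing out the other coordinates leaves [1 - p 0 ord0] and [p 0 ord0]. *)
Lemma fprob_ge0_head m (p : 'rV[R]_m.+1) :
  (forall k, 0 <= fprob p k 0) -> 0 <= p 0 ord0 <= 1.
Proof.
move=> fp0; pose q := \row_i p 0 (lift ord0 i) : 'rV[R]_m.
have ge0 k : 0 <= ber (p 0 ord0) k 0.
  rewrite -[leRHS]mulr1 -(fprob_sum q) mulr_sumr sumr_ge0// => l _.
  have := fp0 (cast_ord (esym (expnS 2 m)) (mxtens_index (k, l))).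
  rewrite !fprobE kron_colS (@eq_kron_col _ _ (fun i => ber (q 0 i))
    (fun i => ber (p 0 (lift ord0 i))))// => i.
  by rewrite mxE.
by have := ge0 0; have := ge0 1; rewrite !berE /= subr_ge0 => -> ->.
Qed.

Definition rescale a b m (p : 'rV[R]_m) : 'rV[R]_m :=
  \row_i ((1 - p 0 i) * a + p 0 i * b).

Definition chan_pow m a b : 'M[R]_(2 ^ m) := kron_pow m (chan a b).

Lemma chan_pow_fprob a b m (p : 'rV[R]_m) :
  chan_pow m a b *m fprob p = fprob (rescale a b p).
Proof.
rewrite !fprobE -kron_col_mul; apply: eq_kron_col => i.
by rewrite chan_ber mxE.
Qed.

(* [y |-> (y - a) / (b - a)] is again of the form [(1 - y) a' + y b']. *)
Definition unscale a b m : 'rV[R]_m -> 'rV[R]_m :=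
  @rescale (- a / (b - a)) ((1 - a) / (b - a)) m.

Definition chan_pow_inv m a b : 'M[R]_(2 ^ m) :=
  chan_pow m (- a / (b - a)) ((1 - a) / (b - a)).

Lemma unscaleE a b m (p : 'rV[R]_m) i :
  unscale a b p 0 i = (p 0 i - a) / (b - a).
Proof. by rewrite mxE; ring. Qed.

(** Kronecker powers multiply factorwise, and the product of the 2 x 2 factors has as parameters the
    images 0 and 1 of [a] and [b] under [y |-> (y - a) / (b - a)]. *)
Lemma chan_powK m a b : a != b -> chan_pow_inv m a b *m chan_pow m a b = 1%:M.
Proof.
move=> ab; rewrite -kron_powM chanM -kron_pow1 -chan01.
have ba : b - a != 0 by rewrite subr_eq0 eq_sym.
by congr (kron_pow _ (chan _ _)); field.
Qed.

Lemma chan_powVK m a b : a != b -> chan_pow m a b *m chan_pow_inv m a b = 1%:M.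
Proof. by move=> ab; apply: mulmx1C; apply: chan_powK. Qed.

End FprobTheory.

(** * The convex hull, its affine hull and its relative interior *)

Section StochasticHull.
Context {R : realType}.
Implicit Types (a b : R) (m : nat).

Lemma mulmx_trE n p (M : 'M[R]_(p, n)) (K : 'M[R]_n) i j :
  (M *m K^T) i j = (K *m (row i M)^T) j 0.
Proof. by rewrite !mxE; apply: eq_bigr => k _; rewrite !mxE mulrC. Qed.

Lemma row_stochastic_convex m : @convex_set R 'M[R]_(2 ^ m) (row_stochastic m).
Proof.
apply/convex_setP => M N t /andP[t0 t1] [M0 M1] [N0 N1]; split=> [i j|i].
  by rewrite !mxE addr_ge0// mulr_ge0 ?subr_ge0.
under eq_bigr do rewrite !mxE.
by rewrite big_split /= -!mulr_sumr M1 N1; ring.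
Qed.

(* A row-stochastic [W] is the mean of the 0-1 matrices with ones at the
   positions [(i, g i)], the rows of [g] being drawn independently according
   to the rows of [W]. *)
Lemma row_stochastic_conv_hull m a b (W : 'M[R]_(2 ^ m)) :
  0 <= a <= 1 -> 0 <= b <= 1 -> row_stochastic m W ->
  conv_hull (hat_Gamma m a b) (W *m (chan_pow m a b)^T).
Proof.
move=> a01 b01 [W0 W1]; set N := (2 ^ m)%N.
pose c (g : {ffun 'I_N -> 'I_N}) := \prod_i W i (g i).
pose D (g : {ffun 'I_N -> 'I_N}) : 'M[R]_N := \matrix_(i, j) (j == g i)%:R.
have WE : W = \sum_g c g *: D g.
  apply/matrixP => i j; rewrite summxE.
  (* The factor [k = i] sums to [W i j] and every other one to 1; expanding the product over all [g]
     keeps those with [g i = j]. *)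
  transitivity (\prod_k \sum_l W k l * ((k != i) || (l == j))%:R).
    rewrite (bigD1 i)//= [X in _ = _ * X]big1 ?mulr1 => [|k ki]; last first.
      by rewrite -[RHS](W1 k); apply: eq_bigr => l _; rewrite ki mulr1.
    rewrite (bigD1 j)//= !eqxx mulr1 big1 ?addr0// => l lj.
    by rewrite (negbTE lj) mulr0.
  rewrite bigA_distr_bigA; apply: eq_bigr => g _; rewrite !mxE big_split /=.
  congr (_ * _); rewrite (bigD1 i)//= eqxx /= [j == _]eq_sym.
  by rewrite big1 ?mulr1// => k ->.
rewrite WE mulmx_suml; under eq_bigr do rewrite -scalemxAl.
apply: (@convex_set_sum _ _ (conv_hull (hat_Gamma m a b)) _ c
  (fun g => D g *m (chan_pow m a b)^T)).
- exact: conv_hull_convex.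
- by move=> g; apply: prodr_ge0 => i _.
- by rewrite -bigA_distr_bigA /= big1// => i _.
move=> g; apply: sub_gen_smallest => i.
have [e e01 eg] := @fprob_delta R _ (g i).
exists (rescale a b e).
  split=> k; rewrite mxE; case: (e01 k) => ->.
  - by rewrite subr0 mul1r mul0r addr0.
  - by rewrite subrr mul0r mul1r add0r.
  - by left; ring.
  - by right; ring.
rewrite -chan_pow_fprob eg row_mul trmx_mul trmxK; congr (_ *m _).
by apply/colP => j; rewrite !mxE eqxx andbT.
Qed.

(** Each row of the product is [fprob (unscale a b q)] with [unscale a b q] in the unit cube.
    Admitting every [q] in the box, not only its vertices, also covers nested intervals and
    [stat_mx]. *)
Lemma row_stochastic_unscale m a b (M : 'M[R]_(2 ^ m)) : a < b ->
  (forall i, exists2 q : 'rV[R]_m, (forall j, a <= q 0 j <= b) &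
    fprob q = (row i M)^T) ->
  row_stochastic m (M *m (chan_pow_inv m a b)^T).
Proof.
move=> ab MG.
have MrowE i : exists2 q : 'rV[R]_m, cube m q &
    forall j, (M *m (chan_pow_inv m a b)^T) i j = fprob q j 0.
  have [q qab qE] := MG i; exists (unscale a b q) => [j|j]; last first.
    by rewrite mulmx_trE -qE chan_pow_fprob.
  rewrite unscaleE; have /andP[aq qb] := qab j.
  have ba : 0 < b - a by rewrite subr_gt0.
  rewrite divr_ge0 ?subr_ge0 ?(ltW ab)//=.
  by rewrite ler_pdivrMr// mul1r lerD2r.
split=> [i j|i]; have [q q01 qE] := MrowE i; first by rewrite qE fprob_ge0.
by under eq_bigr do rewrite qE; rewrite fprob_sum.
Qed.

Lemma conv_hull_hat_Gamma m a b : 0 <= a -> a < b -> b <= 1 ->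
  conv_hull (hat_Gamma m a b) =
  [set M | row_stochastic m (M *m (chan_pow_inv m a b)^T)].
Proof.
move=> a0 ab b1; apply/seteqP; split=> [|M /= MS]; last first.
  rewrite -[M]mulmx1 -trmx1 -(@chan_powVK _ m a b) ?lt_eqF// trmx_mul mulmxA.
  apply: row_stochastic_conv_hull => //.
  - by rewrite a0 (le_trans (ltW ab)).
  - by rewrite b1 (le_trans a0 (ltW ab)).
(* The right-hand side is a linear preimage of a convex set, hence convex; only the generators
   remain to be checked. *)
apply: smallest_sub.
  apply/convex_setP => M N t t01 MS NS /=; rewrite mulmxDl -!scalemxAl.
  by move/convex_setP: (@row_stochastic_convex m); apply.
move=> M MG /=; apply: row_stochastic_unscale => // i.
have [q [_ qab] qE] := MG i; exists q => // j.
by case: (qab j) => ->; rewrite lexx ltW.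
Qed.

Lemma conv_hull_hat_Gamma01 m :
  conv_hull (hat_Gamma m (0 : R) 1) = row_stochastic m.
Proof.
rewrite conv_hull_hat_Gamma// /chan_pow_inv oppr0 addr0 mul0r divr1.
rewrite /chan_pow chan01 kron_pow1 trmx1.
by apply/seteqP; split=> M /=; rewrite mulmx1.
Qed.

Lemma conv_hull_hat_Gamma_sub m a b a' b' :
  0 <= a' -> a' <= a -> a < b -> b <= b' -> b' <= 1 ->
  conv_hull (hat_Gamma m a b) `<=` conv_hull (hat_Gamma m a' b').
Proof.
move=> a'0 a'a ab bb' b'1.
have ab' : a' < b' by apply: le_lt_trans a'a (lt_le_trans ab bb').
apply: smallest_sub; first exact: conv_hull_convex.
move=> M MG; rewrite conv_hull_hat_Gamma//=.
apply: row_stochastic_unscale => //.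
move=> i; have [q [_ qab] qE] := MG i; exists q => // j.
by case: (qab j) => ->; rewrite ?a'a ?bb' ?andbT /= ?(le_trans (ltW ab))//
  (le_trans a'a (ltW ab)).
Qed.

(** The chain whose next state has law [fprob p] whatever the current state. *)
Definition stat_mx m (p : 'rV[R]_m) : 'M[R]_(2 ^ m) :=
  (const_mx 1 : 'cV_(2 ^ m)) *m (fprob p)^T.

Lemma row_stat_mx m (p : 'rV[R]_m) i : (row i (stat_mx p))^T = fprob p.
Proof.
apply/colP => j; rewrite !mxE big_ord1 !mxE mul1r.
by rewrite /= [_ j _](_ : _ = fprob p j 0).
Qed.

(* The right multiplication by [chan_pow_inv] turns [p] into [unscale a b p],
   whose coordinates leave [0, 1] as soon as those of [p] leave [a, b]. *)
Lemma stat_mx_conv_hull m a b x : 0 <= a -> a < b -> b <= 1 ->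
  conv_hull (hat_Gamma m.+1 a b) (stat_mx (const_mx x)) -> a <= x <= b.
Proof.
move=> a0 ab b1; rewrite conv_hull_hat_Gamma//= => -[K0 _].
have ba : 0 < b - a by rewrite subr_gt0.
have N0 : (0 < 2 ^ m.+1)%N by rewrite expn_gt0.
have /fprob_ge0_head : forall k,
    0 <= fprob (unscale a b (const_mx x : 'rV[R]_m.+1)) k 0.
  move=> k; have := K0 (Ordinal N0) k.
  by rewrite mulmx_trE row_stat_mx chan_pow_fprob.
rewrite unscaleE mxE pmulr_lge0 ?invr_gt0// subr_ge0 ler_pdivrMr// mul1r.
by rewrite lerD2r.
Qed.

(** A unit row sum is an affine condition, so it extends to the affine hull, where nonnegativity may
    fail. *)
Lemma affine_hull_sum m a b (N : 'M[R]_(2 ^ m)) :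
  0 <= a -> a < b -> b <= 1 ->
  affine_hull (conv_hull (hat_Gamma m a b)) N ->
  forall i, \sum_j (N *m (chan_pow_inv m a b)^T) i j = 1.
Proof.
move=> a0 ab b1; rewrite conv_hull_hat_Gamma//; move: N; apply: smallest_sub.
  move=> M N t MS NS i; rewrite mulmxDl -!scalemxAl.
  under eq_bigr do rewrite !mxE.
  have := MS i; have := NS i; rewrite big_split /= -!mulr_sumr.
  under eq_bigr do rewrite !mxE.
  move=> ->; under eq_bigr do rewrite !mxE.
  by move=> ->; ring.
by move=> M [].
Qed.

(** Positivity of finitely many continuous entries is an open condition, and [affine_hull_sum]
    supplies the row sums; so all nearby points of the affine hull lie in the convex hull. *)
Lemma stat_mx_relint m a b (p : 'rV[R]_m) : 0 <= a -> a < b -> b <= 1 ->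
  (forall i, a < p 0 i < b) ->
  relint (conv_hull (hat_Gamma m a b)) (stat_mx p).
Proof.
move=> a0 ab b1 pab; split.
  rewrite conv_hull_hat_Gamma//=; apply: row_stochastic_unscale => // i.
  exists p; last by rewrite row_stat_mx.
  by move=> j; have /andP[/ltW -> /ltW ->] := pab j.
set K := chan_pow_inv m a b.
have ba : 0 < b - a by rewrite subr_gt0.
have cts i j : continuous (fun N : 'M[R]_(2 ^ m) => (N *m K^T) i j).
  under eq_fun do rewrite mxE.
  apply: continuous_big => [|k _ N]; first exact: add_continuous.
  by apply: cvgMr_tmp; [exact: nbhs_filter|exact: coord_continuous].
have pos i j : 0 < (stat_mx p *m K^T) i j.
  rewrite mulmx_trE row_stat_mx chan_pow_fprob; apply: fprob_gt0 => k.
  rewrite unscaleE; have /andP[ap pb] := pab k.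
  by rewrite divr_gt0 ?subr_gt0//= ltr_pdivrMr// mul1r ltrD2r.
have near_pos : \forall N \near stat_mx p, forall i j, 0 < (N *m K^T) i j.
  apply: (@filter_forall _ _ (fun i N => forall j, 0 < (N *m K^T) i j)
    (nbhs (stat_mx p)) (nbhs_filter _)) => i.
  apply: (@filter_forall _ _ (fun j N => 0 < (N *m K^T) i j)
    (nbhs (stat_mx p)) (nbhs_filter _)) => j.
  exact: (cts i j (stat_mx p) [set y | 0 < y] (lt_nbhsr (pos i j))).
rewrite /within /=; apply: filterS near_pos => N Npos Naff.
rewrite conv_hull_hat_Gamma//=; split=> [i j|]; first exact: ltW.
exact: affine_hull_sum.
Qed.

End StochasticHull.

Theorem theorem6 (R : realType) (m : nat) (p : 'rV[R]_m)
    (rl' rl ru ru' : R)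
    (hm : (1 <= m)%N) (hp : cube m p)
    (h0 : 0 <= rl') (hl : rl' <= rl) (hlu : rl < ru) (hu : ru <= ru')
    (h1 : ru' <= 1) :
  (rl = 0 /\ ru = 1 ->
     conv_hull (hat_Gamma m rl ru) = row_stochastic m) /\
  (rl' < rl \/ ru < ru' ->
     conv_hull (hat_Gamma m rl ru) `<` conv_hull (hat_Gamma m rl' ru')) /\
  ((forall i, rl < p 0 i < ru) ->
     relint (conv_hull (hat_Gamma m rl ru))
       ((const_mx 1 : 'cV[R]_(2 ^ m)) *m (fprob p)^T)).
Proof.
have rl0 : 0 <= rl by exact: le_trans hl.
have ru1 : ru <= 1 by exact: le_trans h1.
have hlu' : rl' < ru' by exact: le_lt_trans hl (lt_le_trans hlu hu).
split; [|split]; last exact: stat_mx_relint.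
- by move=> [-> ->]; exact: conv_hull_hat_Gamma01.
- move=> strict; split; first exact: conv_hull_hat_Gamma_sub.
  (* For [m = 0] the two hulls coincide; [hm] provides the first coordinate that separates them. *)
  case: m hm {p hp} => // m _ sub.
  (* Tested on constant parameters, the supposed reverse inclusion [sub] would put [[rl', ru']]
     inside [[rl, ru]]; an endpoint then contradicts [strict]. *)
  have bounds x : rl' <= x <= ru' -> rl <= x <= ru.
    move=> xb; apply: (@stat_mx_conv_hull _ m) => //; apply: sub.
    rewrite conv_hull_hat_Gamma//=; apply: row_stochastic_unscale => // i.
    by exists (const_mx x) => [j|]; rewrite ?mxE ?row_stat_mx.
  case: strict => [lt_rl|lt_ru].
  + have /andP[] : rl <= rl' <= ru by apply: bounds; rewrite lexx ltW.
    by rewrite leNgt lt_rl.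
  + have /andP[_] : rl <= ru' <= ru by apply: bounds; rewrite lexx ltW.
    by rewrite leNgt lt_ru.
Qed.
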